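(* Let $X$ be a diffeological space with a weak Riemannian metric $g$, and suppose that $g$ is definite with respect to a generating family $\mathcal{G}$ of the diffeology of $X$ which separates points. Then the pseudodistance $d$ on $X$ defined by $g$ is a distance; that is, $d(p,q)=0$ implies $p=q$.
   Context: A domain is an open subset of some $\mathbb{R}^n$, $n\ge 0$. A diffeology $\mathcal{D}$ on a set $X$ is a set of maps $P\colon U_P\to X$ from domains (called plots) that contains all constant maps from domains, is closed under precomposition with smooth maps between domains, and is local (a map $U\to X$ from a domain whose restrictions to the members of some open cover of $U$ are plots is a plot). A map between diffeological spaces is smooth if its composite with every plot is a plot. Domains carry the standard diffeology of all usual smooth maps from domains. Generating family: a set $\mathcal{G}\subset\mathcal{D}$ such that a map $P\colon U_P\to X$ from a domain is in $\mathcal{D}$ iff every $r\in U_P$ has an open neighborhood $V$ in $U_P$ such that $P|_V$ is constant or $P|_V=Q\circ f$ for some $Q\in\mathcal{G}$ and smooth $f\colon V\to U_Q$. Tangent construction: regard $\mathcal{D}$ as a category whose objects are plots and whose morphisms $P\to Q$ are smooth maps $h\colon U_P\to U_Q$ with $Q\circ h=P$. Put $T_2(X)=\operatorname{colim}_{P\in\mathcal{D}}\,(U_P\times\mathbb{R}^{\dim U_P}\times\mathbb{R}^{\dim U_P})$, where $h$ acts by $(r,v,w)\mapsto(h(r),Jh_r v,Jh_r w)$; $[r,v,w]_P$ denotes the class of $(r,v,w)$. A weak Riemannian metric on $X$ is a map $g\colon T_2(X)\to\mathbb{R}$ such that for every plot $P$ the map $g(P)_r(v,w):=g([r,v,w]_P)$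 is a smooth symmetric covariant $2$-tensor on $U_P$ which is positive, i.e. $g(P)_r(v,v)\ge 0$. It is definite with respect to a generating family $\mathcal{G}$ if for every $P\in\mathcal{G}$, $r\in U_P$, $v\in T_rU_P$: $g(P)_r(v,v)=0$ implies $v=0$. Pseudodistance: $d(x,y)=\inf_\gamma \ell(\gamma)\in[0,\infty]$, with the infimum over smooth $\gamma\colon\mathbb{R}\to X$ with $\gamma(0)=x$, $\gamma(1)=y$, and $\ell(\gamma)=\int_0^1 (g(\gamma)_t(1,1))^{1/2}\,dt$; $d(x,y)=\infty$ if there is no such $\gamma$. $\mathcal{G}$ separates points if for all distinct $p,q\in X$ there exist a plot $P\in\mathcal{G}$ and an open ball $B$ with center $x$ such that $P(x)=p$, $B\subset\overline{B}\subset U_P$, and each smooth path $\gamma$ from $p$ to $q$ admits a local lift $\widetilde{\gamma}$ in $U_P$ with $\widetilde\gamma(0)=x$ and $\operatorname{Im}\widetilde\gamma\not\subset B$. Here a local lift of $\gamma$ means a smooth map $\widetilde\gamma\colon J\to U_P$ defined on an interval $J\subset[0,1]$ containing $0$ (a neighborhood of $0$ in $[0,1]$) with $P\circ\widetilde\gamma=\gamma|_J$. *)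

(* Defs.v *)
From HB Require Import structures.
From mathcomp Require Import all_boot all_order all_algebra.
From mathcomp Require Import all_classical all_reals all_analysis.
From Stdlib Require Import Relation_Operators.

Set Implicit Arguments.
Unset Strict Implicit.
Unset Printing Implicit Defensive.

Import Order.TTheory GRing.Theory Num.Theory.
Import numFieldNormedType.Exports.

Local Open Scope classical_set_scope.
Local Open Scope quotient_scope.
Local Open Scope ring_scope.

Record domain (R : realType) := Domain {
  dim : nat;
  dset :> set 'rV[R]_dim;
  dset_open : open dset }.
Arguments Domain {R dim} dset dset_open.

(* Only the values of f on A matter when A is open. *)
Fixpoint Ck_on (R : realType) (n : nat) (W : normedModType R) (k : nat)
    (A : set 'rV[R]_n) (f : 'rV[R]_n -> W) : Prop :=
  if k is k'.+1 then
    (forall x, A x -> differentiable f x) /\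
    (forall v : 'rV[R]_n, Ck_on k' A ('D_v f))
  else forall x, A x -> {for x, continuous f}.

(* A function on a domain is extended by 0 so that the total operators of the
   library (differential, directional derivative) apply to it. *)
Definition ext0 (R : realType) (U : domain R) (W : normedModType R)
  (f : U -> W) : 'rV[R]_(dim U) -> W := 'valL_0 f.

Definition smooth (R : realType) (U : domain R) (W : normedModType R)
  (f : U -> W) : Prop := forall k, Ck_on k U (ext0 f).

Definition emb (R : realType) (U V : domain R) (h : U -> V) :
  U -> 'rV[R]_(dim V) := fun x => \val (h x).

Definition smooth_map (R : realType) (U V : domain R) (h : U -> V) : Prop :=
  smooth (emb h).

(* J h_r v, as a row vector *)
Definition tangent_map (R : realType) (U V : domain R) (h : U -> V) (r : U)
  (v : 'rV[R]_(dim U)) : 'rV[R]_(dim V) := 'd (ext0 (emb h)) (\val r) v.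

Definition incl (T : Type) (A B : set T) (AB : A `<=` B) (x : A) : B :=
  exist _ (\val x) (mem_set (AB _ (set_valP x))).

Record diffeology (R : realType) (X : Type) := Diffeology {
  is_plot : forall U : domain R, set (U -> X);
  is_plot_cst : forall (U : domain R) (c : X), is_plot (fun _ : U => c);
  is_plot_comp : forall (U V : domain R) (P : U -> X) (f : V -> U),
    is_plot P -> smooth_map f -> is_plot (P \o f);
  is_plot_local : forall (U : domain R) (P : U -> X)
      (I : Type) (V : I -> set 'rV[R]_(dim U))
      (Vo : forall i, open (V i)) (VU : forall i, V i `<=` U),
    \bigcup_i V i = U ->
    (forall i, @is_plot (Domain (V i) (Vo i)) (P \o incl (VU i))) ->
    is_plot P }.

Record plot (R : realType) (X : Type) (D : diffeology R X) := Plot {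
  pdom : domain R;
  pmap :> pdom -> X;
  plotP : is_plot D pmap }.

Definition generating (R : realType) (X : Type) (D : diffeology R X)
    (G : set (plot D)) : Prop :=
  forall (U : domain R) (P : U -> X),
    is_plot D P <->
    forall r : U, exists (V : set 'rV[R]_(dim U)) (Vo : open V) (VU : V `<=` U),
      V (\val r) /\
      ((exists c : X, forall x : V, P (incl VU x) = c) \/
       (exists (Q : plot D) (f : Domain V Vo -> pdom Q),
          [/\ G Q, smooth_map f & P \o incl VU = Q \o f])).

Section TangentColimit.
Variables (R : realType) (X : Type) (D : diffeology R X).

Definition pretangent2 : Type :=
  {P : plot D & (pdom P * 'rV[R]_(dim (pdom P)) * 'rV[R]_(dim (pdom P)))%type}.

HB.instance Definition _ := gen_eqMixin pretangent2.
HB.instance Definition _ := gen_choiceMixin pretangent2.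

Definition pretan (P : plot D) (r : pdom P) (v w : 'rV[R]_(dim (pdom P))) :
  pretangent2 := existT _ P (r, v, w).

Inductive tan_step : pretangent2 -> pretangent2 -> Prop :=
| TanStep (P Q : plot D) (h : pdom P -> pdom Q) :
    smooth_map h -> Q \o h = P -> forall (r : pdom P) (v w : 'rV[R]_(dim (pdom P))),
    tan_step (pretan r v w)
             (pretan (h r) (tangent_map h r v) (tangent_map h r w)).

Definition tan_eqv (a b : pretangent2) : bool :=
  `[< clos_refl_sym_trans _ tan_step a b >].

Lemma tan_eqv_refl : reflexive tan_eqv.
Proof. by move=> a; apply/asboolP; exact: rst_refl. Qed.

Lemma tan_eqv_sym : symmetric tan_eqv.
Proof. by move=> a b; apply/asboolP/asboolP; exact: rst_sym. Qed.

Lemma tan_eqv_trans : transitive tan_eqv.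
Proof. by move=> b a c /asboolP ab /asboolP bc; apply/asboolP; exact: rst_trans bc. Qed.

Canonical tan_equiv := EquivRel tan_eqv tan_eqv_refl tan_eqv_sym tan_eqv_trans.

(* The colimit of sets T_2(X), i.e. the disjoint union over all plots modulo
   the equivalence relation generated by the morphisms of plots. *)
Definition tangent2 : Type := {eq_quot tan_equiv}.

Definition tan_class (P : plot D) (r : pdom P) (v w : 'rV[R]_(dim (pdom P))) :
  tangent2 := \pi_({eq_quot tan_equiv}) (pretan r v w).

Definition metric_at (g : tangent2 -> R) (P : plot D) (r : pdom P)
  (v w : 'rV[R]_(dim (pdom P))) : R := g (tan_class r v w).

End TangentColimit.

Record weak_riemannian (R : realType) (X : Type) (D : diffeology R X)
    (g : tangent2 D -> R) : Prop := WeakRiemannian {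
  metric_linl : forall (P : plot D) (r : pdom P) w,
    scalar (fun v => metric_at g r v w);
  metric_linr : forall (P : plot D) (r : pdom P) v, scalar (metric_at g r v);
  metric_sym : forall (P : plot D) (r : pdom P) v w,
    metric_at g r v w = metric_at g r w v;
  metric_smooth : forall (P : plot D) v w,
    smooth ((fun r : pdom P => metric_at g r v w) : pdom P -> R^o);
  metric_pos : forall (P : plot D) (r : pdom P) v, 0 <= metric_at g r v v }.

Definition definite (R : realType) (X : Type) (D : diffeology R X)
    (g : tangent2 D -> R) (G : set (plot D)) : Prop :=
  forall P : plot D, G P -> forall (r : pdom P) v, metric_at g r v v = 0 -> v = 0.

Section Paths.
Variables (R : realType) (X : Type) (D : diffeology R X).

(* Smoothness of a map from R, with its standard diffeology, to X. *)
Definition smooth_path (c : R -> X) : Prop :=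
  forall (U : domain R) (f : U -> R),
    smooth (f : U -> R^o) -> is_plot D (c \o f).

Definition line : domain R := Domain [set: 'rV[R]_1] openT.

Definition line_pt (t : R) : line := exist _ (const_mx t) (mem_set I).

Definition line_coord (x : line) : R := \val x 0 0.

Lemma line_coord_smooth : smooth (line_coord : line -> R^o).
Proof.
have Ccst k (c : R^o) : Ck_on k [set: 'rV[R]_1] (cst c).
  elim: k c => [|k IHk] c /=; first by move=> x _; exact: cst_continuous.
  split=> [x _|v]; first exact: differentiable_cst.
  rewrite (_ : 'D_v (cst c) = cst 0) //.
  by apply/funext => x; exact: derive_cst.
pose coord0 (x : 'rV[R]_1) : R^o := x 0 0.
have coordE : ext0 (line_coord : line -> R^o) = coord0.
  apply/funext => x.
  exact: (congr1 (@^~ (exist _ x (mem_set I) : line))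
    (valLK (0 : R^o) (line_coord : line -> R^o))).
have dcoord x : differentiable coord0 x by exact: differentiable_coord.
case=> [|k]; rewrite coordE /=; first by move=> x _; exact: coord_continuous.
split=> // v; rewrite (_ : 'D_v coord0 = cst (coord0 v)) //.
apply/funext => x; rewrite deriveE //.
have lcoord : linear coord0 by move=> a u w; rewrite /coord0 !mxE.
pose lf := GRing.isLinear.Build _ _ _ _ coord0 lcoord.
pose f : {linear 'rV[R]_1 -> R^o} := HB.pack coord0 lf.
by rewrite (diff_lin (f := f))//; exact: coord_continuous.
Qed.

Definition path_plot (c : R -> X) (cs : smooth_path c) : plot D :=
  Plot (cs line line_coord line_coord_smooth).

Definition path_length (g : tangent2 D -> R) (c : R -> X)
    (cs : smooth_path c) : \bar R :=
  (\int[lebesgue_measure]_(t in `[0%R, 1%R])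
    (Num.sqrt (metric_at g (line_pt t : pdom (path_plot cs))
                 (const_mx 1) (const_mx 1)))%:E)%E.

Definition pseudodistance (g : tangent2 D -> R) (x y : X) : \bar R :=
  ereal_inf [set l | exists (c : R -> X) (cs : smooth_path c),
    [/\ c 0 = x, c 1 = y & l = path_length g cs]].

End Paths.

(* The library norm on row vectors is the sup norm; balls in R^n are
   Euclidean. *)
Definition eball (R : realType) (n : nat) (x : 'rV[R]_n) (e : R) :
    set 'rV[R]_n :=
  [set y | Num.sqrt (\sum_i (y 0 i - x 0 i) ^+ 2) < e].

(* Smoothness for the subset diffeology of J in R: J is in general not open
   (it contains an end point), so the curve is tested on the smooth functions
   from domains with values in J. *)
Definition smooth_curve (R : realType) (J : set R) (U : domain R)
    (c : J -> U) : Prop :=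
  forall (V : domain R) (f : V -> J),
    smooth ((fun x => \val (f x)) : V -> R^o) -> smooth_map (c \o f).

(* [0, b[ `<=` J says that J contains 0 and is a neighborhood of 0 in [0, 1]. *)
Definition local_lift (R : realType) (X : Type) (D : diffeology R X)
    (P : plot D) (c : R -> X) (J : set R) (ct : J -> pdom P) : Prop :=
  [/\ is_interval J, J `<=` `[0, 1],
      (exists2 b : R, 0 < b & `[0, b[ `<=` J),
      smooth_curve ct & forall t : J, P (ct t) = c (\val t)].

Definition separates_points (R : realType) (X : Type) (D : diffeology R X)
    (G : set (plot D)) : Prop :=
  forall p q : X, p <> q ->
  exists (P : plot D) (x : pdom P) (e : R),
    [/\ G P, 0 < e, P x = p, closure (eball (\val x) e) `<=` pdom P &
      forall c : R -> X, smooth_path D c -> c 0 = p -> c 1 = q ->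
      exists (J : set R) (ct : J -> pdom P),
        [/\ local_lift c ct, (forall t : J, \val t = 0 -> ct t = x) &
            exists t : J, ~ eball (\val x) e (\val (ct t))]].

(* Main.v *)
(* By definiteness and continuity, the metric of the chart P dominates m^2 times
   the squared sup norm on a small ball of radius d around the point x over p.
   A path from p to q lifts to P, starts at x and leaves this ball. The class
   in T_2(X) of its velocity is the class of the velocity of the lift, so the
   path has at least the length of the lift, hence length at least m d. *)
From HB Require Import structures.
Require Import Defs.
From mathcomp Require Import all_boot all_order all_algebra.
From mathcomp Require Import all_classical all_reals all_analysis.
From mathcomp Require Import ring lra.
From Stdlib Require Import Relation_Operators.

Set Implicit Arguments.
Unset Strict Implicit.
Unset Printing Implicit Defensive.

Import Order.TTheory GRing.Theory Num.Theory.
Import numFieldNormedType.Exports.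

Local Open Scope classical_set_scope.
Local Open Scope ring_scope.

(** * Sup norm of matrices and calculus on the real line *)

Lemma ler_mx_norm_entry (R : realType) (m n : nat) (A : 'M[R]_(m, n)) i j :
  `|A i j| <= `|A|.
Proof.
by rewrite [leRHS]/Num.norm /= mx_normrE; apply/bigmax_geP; right => /=; exists (i, j).
Qed.

Lemma mx_norm_le (R : realType) (m n : nat) (A : 'M[R]_(m, n)) (e : R) :
  0 <= e -> (forall i j, `|A i j| <= e) -> `|A| <= e.
Proof.
move=> e0 Ae; rewrite [leLHS]/Num.norm /= mx_normrE.
by apply/bigmax_leP; split => // -[i j] _ /=.
Qed.

Lemma continuous_primitive (R : realType) (h : R -> R) (a b : R) :
  continuous h -> (forall t, 0 <= h t) -> a <= b ->
  exists2 L : R -> R, (forall t, a <= t <= b -> is_derive t 1 L (h t)) &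
    (\int[lebesgue_measure]_(t in `[a, b]) (h t)%:E)%E = (L b - L a)%:E.
Proof.
move=> hc h0 ab.
have hint c d : lebesgue_measure.-integrable `[c, d] (EFin \o h).
  apply: continuous_compact_integrable; first exact: segment_compact.
  exact: continuous_subspaceT.
(* The primitive starts at [a - 1], so that [a] is an interior point and the derivative there is
   two-sided as well. *)
exists (fun t => \int[lebesgue_measure]_(s in `[a - 1, t]) h s) => [t /andP[ta tb]|].
  have [||||dL L'] := @continuous_FTC1_closed R h (a - 1) t (t + 1).
  - by rewrite ltrDl.
  - exact: hint.
  - lra.
  - exact: hc.
  by split; [exact: dL|rewrite -derive1E; exact: L'].
rewrite Rintegral_itvB ?bnd_simp //; last by lra.
rewrite Rintegral_itv_obnd_cbnd; last first.
  by apply: integrableS (hint a b) => //; apply: subset_itv_oc_cc.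
rewrite /Rintegral fineK //.
by rewrite integrable_fin_num //; exact: hint.
Qed.

(* The speed bound holds up to the first time s1 at which u is at distance d
   from u 0; until then each coordinate of u varies less than phi does. *)
Lemma exit_speed_bound (R : realType) (n : nat) (u du : R -> 'rV[R]_n)
    (phi dphi : R -> R) (b d : R) :
  0 <= b ->
  (forall (s : R) i, is_derive s 1 (fun t => u t 0 i) (du s 0 i)) ->
  continuous u ->
  (forall s : R, 0 <= s <= b -> is_derive s 1 phi (dphi s)) ->
  (forall s, 0 <= s <= b -> 0 <= dphi s) ->
  (forall s, 0 <= s <= b -> `|u s - u 0| < d -> `|du s| <= dphi s) ->
  d <= `|u b - u 0| -> d <= phi b - phi 0.
Proof.
move=> b0 du' uc dphi' dphi0 speed far.
(* [A] is compact and contains [b], so it has a least element, the exit time [s1]. *)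
pose A := `[0, b] `&` [set s : R | d <= `|u s - u 0|].
have Acpt : compact A.
  apply: (@subclosed_compact _ _ `[0, b]); last exact: subIsetl.
    apply: closedI; first exact: interval_closed.
    apply: (@closed_comp R R (fun s => `|u s - u 0|) [set x | d <= x]).
      move=> s _; apply: cvg_norm; apply: cvgB; [exact: uc|exact: cvg_cst].
    exact: closed_ge.
  exact: segment_compact.
have Ane : A !=set0 by exists b; split => //=; rewrite in_itv /= b0 lexx.
have [|s1 /set_mem[/=]] := @compact_EVT_min R R id A Ane Acpt.
  by apply: continuous_subspaceT => ?; exact: cvg_id.
rewrite in_itv /= => /andP[s10 s1b] s1far s1min.
have before s : 0 <= s < s1 -> `|u s - u 0| < d.
  move=> /andP[s0 ss1]; rewrite ltNge; apply/negP => dus.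
  have : s \in A by apply/mem_set; split => //=; rewrite in_itv /= s0; lra.
  by move=> /s1min; rewrite leNgt ss1.
have phi_mono c e : 0 <= c -> c <= e -> e <= b -> phi c <= phi e.
  move=> c0 ce eb.
  have D s : s \in `]c, e[ -> is_derive s 1 phi (dphi s).
    by rewrite in_itv /= => ?; apply: dphi'; lra.
  apply: (@ger0_derive1_le R phi c e _ _ true false).
  - by move=> s /D [].
  - move=> s sI; rewrite derive1E (@derive_val _ _ _ _ _ _ _ (D s sI)).
    by move: sI; rewrite in_itv /= => ?; apply: dphi0; lra.
  - apply: derivable_within_continuous => s; rewrite in_itv /= => ?.
    by have [] : is_derive s 1 phi (dphi s) by apply: dphi'; lra.
  - by rewrite in_itv /= lexx.
  - by rewrite in_itv /= lexx andbT.
  - done.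
(* The signs [1] and [-1] for [eps] together bound the absolute value of a coordinate. The
   derivative of [psi] is nonnegative inside []0, s1[] because an entry of [du s] is at most
   [|du s|]; at [s1] itself [speed] no longer applies, but monotonicity needs only interior
   points. *)
have coord (eps : R) i : `|eps| = 1 ->
    eps * (u s1 0 i - u 0 0 i) <= phi s1 - phi 0.
  move=> eps1.
  pose psi (s : R) := phi s - eps * u s 0 i.
  have D s : 0 <= s <= s1 -> is_derive s 1 psi (dphi s - eps * du s 0 i).
    move=> /andP[s0 ss1]; have := du' s i => ?.
    have ? : is_derive s 1 phi (dphi s) by apply: dphi'; lra.
    exact: is_deriveB.
  have : psi 0 <= psi s1.
    apply: (@ger0_derive1_le R psi 0 s1 _ _ true false).
    - move=> s; rewrite in_itv /= => sI.
      by have [] : is_derive s 1 psi (dphi s - eps * du s 0 i) by apply: D; lra.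
    - move=> s; rewrite in_itv /= => sI.
      have /D Ds : 0 <= s <= s1 by lra.
      rewrite derive1E (@derive_val _ _ _ _ _ _ _ Ds) subr_ge0.
      apply: le_trans (ler_norm _) _; rewrite normrM eps1 mul1r.
      apply: le_trans (ler_mx_norm_entry _ _ _) _.
      by apply: speed; [lra|apply: before; lra].
    - apply: derivable_within_continuous => s; rewrite in_itv /= => sI.
      by have [] : is_derive s 1 psi (dphi s - eps * du s 0 i) by apply: D.
    - by rewrite in_itv /= lexx.
    - by rewrite in_itv /= lexx andbT.
    - done.
  by rewrite /psi; lra.
apply: (le_trans s1far); apply: (@le_trans _ _ (phi s1 - phi 0)); last first.
  by rewrite lerD2r; apply: phi_mono.
apply: mx_norm_le; first by rewrite subr_ge0 phi_mono.
move=> i j; rewrite ord1 !mxE ler_norml; apply/andP; split.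
  by have := coord (-1) j; rewrite normrN1 => /(_ erefl); lra.
by have := coord 1 j; rewrite normr1 => /(_ erefl); lra.
Qed.

(** * Euclidean balls and coordinate functions *)

Lemma cvg_sumr (R : realType) (T I : Type) (F : set_system T) (FF : Filter F)
    (r : seq I) (f : I -> T -> R) (l : I -> R) :
  (forall i, f i x @[x --> F] --> l i) ->
  \sum_(i <- r) f i x @[x --> F] --> \sum_(i <- r) l i.
Proof. by move=> fl; apply: cvg_big => //; exact: add_continuous. Qed.

(** The Euclidean distance to [x] is continuous for the sup norm and vanishes at [x]. *)
Lemma eball_nbhs (R : realType) (n : nat) (x : 'rV[R]_n) (e : R) :
  0 < e -> nbhs x (eball x e).
Proof.
move=> e0.
pose f (y : 'rV[R]_n) := Num.sqrt (\sum_i (y 0 i - x 0 i) ^+ 2).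
have fc : continuous f.
  move=> y.
  have fy : (fun z : 'rV[R]_n => \sum_i (z 0 i - x 0 i) ^+ 2) @ y -->
    \sum_i (y 0 i - x 0 i) ^+ 2.
    apply: (@cvg_sumr R _ _ (nbhs y) _) => i.
    have yc : (fun z : 'rV[R]_n => z 0 i) @ y --> y 0 i by exact: coord_continuous.
    have yi : (fun z : 'rV[R]_n => z 0 i - x 0 i) @ y --> y 0 i - x 0 i.
      by apply: (cvgB yc); exact: cvg_cst.
    by apply: (cvgM yi); exact: yi.
  apply: (@continuous_comp _ _ _ _ (Num.sqrt : R -> R)); first exact: fy.
  exact: sqrt_continuous.
have fx : f x < e by rewrite /f big1 ?sqrtr0 // => i _; rewrite subrr expr0n.
exact: (cvgr_lt (f x) (fc x) e fx).
Qed.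

Lemma diff_coord (R : realType) (n : nat) (x v : 'rV[R]_n) i :
  'd (fun y : 'rV[R]_n => y 0 i : R) x v = v 0 i.
Proof.
pose coord (y : 'rV[R]_n) : R := y 0 i.
have coord_lin : linear coord by move=> k y z; rewrite /coord !mxE.
pose L : {linear 'rV[R]_n -> R} :=
  HB.pack coord (GRing.isLinear.Build _ _ _ _ coord coord_lin).
by rewrite (@diff_lin _ _ _ L) //; exact: coord_continuous.
Qed.

(** * Smoothness of trigonometric curves *)

Section TrigCurves.
Variables (R : realType) (W : normedModType R) (w : W).

(** This family is closed under directional derivatives, so smoothness follows by induction on the
    order. The constant [c] is there to include [t0 / 2 * (1 - cos s)], the reparametrization of
    lifts. *)
Let trig (a b c : R) (x : 'rV[R]_1) : W :=
  (a * cos (x 0 0) + b * sin (x 0 0) + c) *: w.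

Lemma trig_differentiable a b c x : differentiable (trig a b c) x.
Proof.
apply: differentiableZl.
apply: (@differentiable_comp _ _ _ _ (fun y : 'rV[R]_1 => y 0 0 : R)
  (fun t : R => a * cos t + b * sin t + c)).
  exact: differentiable_coord.
exact/derivable1_diffP.
Qed.

Lemma trig_derive a b c x v :
  'd (trig a b c) x v = trig (b * v 0 0) (- a * v 0 0) 0 x.
Proof.
pose coord (y : 'rV[R]_1) : R := y 0 0.
pose phi (t : R) := a * cos t + b * sin t + c.
have dcoord : differentiable coord x by exact: differentiable_coord.
have phi' : is_derive (x 0 0 : R) 1 phi (- a * sin (x 0 0) + b * cos (x 0 0)).
  by apply: is_derive_eq; rewrite /GRing.scale /=; ring.
have dphi : differentiable phi (coord x) by apply/derivable1_diffP; case: phi'.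
rewrite /trig (@diffZl _ _ _ (phi \o coord)); last exact: differentiable_comp.
rewrite diff_comp //= diff_coord diff1E // derive1E (@derive_val _ _ _ _ _ _ _ phi').
by congr (_ *: _); rewrite /GRing.scale /=; ring.
Qed.

Lemma trig_Ck k a b c : Ck_on k [set: 'rV[R]_1] (trig a b c).
Proof.
elim: k a b c => [|k IHk] a b c /=.
  by move=> x _; apply: differentiable_continuous; exact: trig_differentiable.
split=> [x _|v]; first exact: trig_differentiable.
rewrite (_ : 'D_v _ = trig (b * v 0 0) (- a * v 0 0) 0) //.
by apply/funext => x; rewrite deriveE ?trig_derive //; exact: trig_differentiable.
Qed.

End TrigCurves.

(** * The metric in a chart and its lower bound near a point *)

Lemma ext0E (R : realType) (U : domain R) (W : normedModType R) (f : U -> W)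
  (x : U) : ext0 f (\val x) = f x.
Proof. exact: (congr1 (@^~ x) (valLK (0 : W) f)). Qed.

(** The two triples are one generating step of the colimit apart, hence have the same class in
    T_2(X). *)
Lemma metric_at_morphism (R : realType) (X : Type) (D : diffeology R X)
    (g : tangent2 D -> R) (P Q : plot D) (h : pdom P -> pdom Q) (r : pdom P) v w :
  smooth_map h -> Q \o h = P ->
  metric_at g r v w = metric_at g (h r) (tangent_map h r v) (tangent_map h r w).
Proof.
move=> hs QhP; congr g; apply/eqmodP/asboolP; apply: rst_step.
exact: TanStep.
Qed.

(** Reduces a metric in a chart to finitely many coefficients, each of which is a smooth function of
    the base point by [metric_smooth]. *)
Lemma bilinear_rV (R : realType) (n : nat) (B : 'rV[R]_n -> 'rV[R]_n -> R) v w :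
  (forall w, scalar (B^~ w)) -> (forall v, scalar (B v)) ->
  B v w = \sum_(p : 'I_n * 'I_n)
    v 0 p.1 * w 0 p.2 * B (delta_mx 0 p.1) (delta_mx 0 p.2).
Proof.
move=> linl linr.
have expand (f : 'rV[R]_n -> R) u : scalar f ->
    f u = \sum_i u 0 i * f (delta_mx 0 i).
  move=> flin; pose F : {scalar 'rV[R]_n} :=
    HB.pack f (GRing.isLinear.Build _ _ _ _ f flin).
  rewrite {1}(row_sum_delta u) -[f]/(F : _ -> _) linear_sum.
  by apply: eq_bigr => i _; rewrite linearZ.
rewrite (expand (B^~ w)) // -(pair_big xpredT xpredT
  (fun i j => v 0 i * w 0 j * B (delta_mx 0 i) (delta_mx 0 j))) /=.
apply: eq_bigr => i _; rewrite (expand (B _)) // mulr_sumr.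
by apply: eq_bigr => j _; rewrite mulrA.
Qed.

(** Compactness of the unit sphere gives a bound [mu * |v| ^+ 2] at [x]; near [x], continuity of the
    coefficients costs at most half of it. *)
Lemma definite_lower_bound (R : realType) (X : Type) (D : diffeology R X)
    (g : tangent2 D -> R) (P : plot D) (x : pdom P) :
  weak_riemannian g -> (forall v, metric_at g x v v = 0 -> v = 0) ->
  exists2 m : R, 0 < m & \forall y \near \val x, forall r : pdom P, \val r = y ->
    forall v, m * `|v| <= Num.sqrt (metric_at g r v v).
Proof.
move=> gR gdef; set n := Defs.dim (pdom P) in gdef *.
pose G (p : 'I_n * 'I_n) : 'rV[R]_n -> R^o :=
  ext0 (fun r : pdom P => metric_at g r (delta_mx 0 p.1) (delta_mx 0 p.2) : R^o).
have gE (r : pdom P) (v : 'rV[R]_n) :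
    metric_at g r v v = \sum_p v 0 p.1 * v 0 p.2 * G p (\val r).
  rewrite (bilinear_rV _ _ (metric_linl gR r) (metric_linr gR r)).
  by apply: eq_bigr => p _; rewrite /G ext0E.
pose q (v : 'rV[R]_n) : R := \sum_p v 0 p.1 * v 0 p.2 * G p (\val x).
have qE v : q v = metric_at g x v v by rewrite gE.
have qZ a v : q (a *: v) = a ^+ 2 * q v.
  by rewrite /q mulr_sumr; apply: eq_bigr => p _; rewrite !mxE; ring.
have qc : continuous q.
  move=> v; apply: (@cvg_sumr R _ _ (nbhs v) _) => p.
  have vc i : (fun z : 'rV[R]_n => z 0 i) @ v --> v 0 i by exact: coord_continuous.
  by apply: cvgM; [apply: (cvgM (vc p.1)); exact: vc|exact: cvg_cst].
pose S := [set v : 'rV[R]_n | `|v| = 1].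
have Sunit (v : 'rV[R]_n) : v != 0 -> S (`|v|^-1 *: v).
  move=> v0; rewrite /S /= normrZ normfV normr_id mulVf //.
  by rewrite normr_eq0.
have Scpt : compact S.
  apply: bounded_closed_compact.
    by exists 1; split; [exact: num_real|move=> M M1 v /= ->; exact: ltW].
  apply: (@closed_comp _ R (fun v : 'rV[R]_n => `|v|) [set y | y = 1]).
    by move=> v _; exact: norm_continuous.
  exact: closed_eq.
have [mu mu0 qmu] : exists2 mu : R, 0 < mu & forall v, mu * `|v| ^+ 2 <= q v.
  (* In dimension 0 the sphere is empty and every vector is 0, so any positive constant serves. *)
  have [S0|S0] := eqVneq S set0.
    exists 1 => // v; have [->|/Sunit] := eqVneq v 0; last by rewrite S0.
    by rewrite normr0 expr0n mulr0 qE (metric_pos gR).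
  have [|c /set_mem Sc cmin] := EVT_min_rV ((set0P _).1 S0) Scpt (f := q).
    exact: continuous_subspaceT.
  (* The minimum of [q] on the sphere is positive, since [q c = 0] would force [c = 0] by
     definiteness. Homogeneity carries the bound to all vectors. *)
  exists (q c).
    rewrite lt_neqAle qE (metric_pos gR) andbT eq_sym; apply/eqP => /gdef c0.
    by move: Sc; rewrite /S /= c0 normr0 => /esym/eqP; rewrite oner_eq0.
  move=> v; have [->|v0] := eqVneq v 0.
    by rewrite normr0 expr0n mulr0 qE (metric_pos gR).
  have /mem_set/cmin := Sunit _ v0.
  rewrite qZ exprVn mulrC ler_pdivlMr //.
  by rewrite exprn_gt0 // normr_gt0.
exists (Num.sqrt (mu / 2)); first by rewrite sqrtr_gt0 divr_gt0.
(* Since [|v 0 i| <= |v|], the quadratic form changes between [x] and [y] by at most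
   [err y * |v| ^+ 2]. *)
pose err (y : 'rV[R]_n) : R := \sum_p `|G p y - G p (\val x)|.
have errc : err @ \val x --> err (\val x).
  apply: (@cvg_sumr R _ _ (nbhs (\val x)) _) => p.
  apply: cvg_norm; apply: cvgB; last exact: cvg_cst.
  exact: (metric_smooth gR _ _ 0%N _ (set_valP x)).
have err0 : err (\val x) < mu / 2.
  by rewrite /err big1 ?divr_gt0 // => p _; rewrite subrr normr0.
have near_err : \forall y \near \val x, err y < mu / 2.
  exact: cvgr_lt errc _ err0.
apply: filterS near_err => y erry r ry v.
have gq : q v - metric_at g r v v <= err y * `|v| ^+ 2.
  rewrite gE /q -sumrB ry mulr_suml; apply: ler_sum => p _.
  rewrite -mulrBr; apply: le_trans (ler_norm _) _.
  rewrite !normrM distrC mulrC; apply: ler_wpM2l => //.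
  by rewrite expr2; apply: ler_pM => //; exact: ler_mx_norm_entry.
rewrite -[`|v|]ger0_norm // -sqrtr_sqr -sqrtrM; last by rewrite divr_ge0 // ltW.
apply: ler_wsqrtr.
move: gq (qmu v) (sqr_ge0 `|v|); set N := `|v| ^+ 2 => gq qN N0.
have : err y * N <= mu / 2 * N by apply: ler_wpM2r => //; exact: ltW.
lra.
Qed.

(** * Curves defined on the whole line *)

Lemma ext0_line (R : realType) (W : normedModType R) (f : 'rV[R]_1 -> W) :
  ext0 (fun s : line R => f (\val s)) = f.
Proof.
apply/funext => s.
exact: (ext0E (fun s : line R => f (\val s)) (exist _ s (mem_set I))).
Qed.

Lemma smooth_line (R : realType) (W : normedModType R) (f : 'rV[R]_1 -> W) :
  (forall k, Ck_on k [set: 'rV[R]_1] f) ->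
  smooth (fun s : line R => f (\val s)).
Proof. by move=> fC k; rewrite (ext0_line f). Qed.

(** Shows the vector under [line_pt t] as a linear function of [t], which is its own
    differential. *)
Lemma const_mx_scale (R : realType) (t : R) :
  const_mx t = t *: const_mx 1 :> 'rV[R]_1.
Proof. by apply/matrixP => i j; rewrite !mxE mulr1. Qed.

(** Chain rule for a coordinate, [h] and the linear map [scal]; the two outer maps are linear and so
    contribute no further terms. *)
Lemma line_curve_derive (R : realType) (V : domain R) (h : line R -> V) (s : R) i :
  smooth_map h ->
  is_derive s 1 (fun t => \val (h (line_pt t)) 0 i)
    (tangent_map h (line_pt s) (const_mx 1) 0 i).
Proof.
move=> hs.
pose scal (t : R) : 'rV[R]_1 := t *: const_mx 1.
pose u := ext0 (emb h) \o scal.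
pose coord (y : 'rV[R]_(Defs.dim V)) : R := y 0 i.
have uE : (fun t => \val (h (line_pt t)) 0 i) = coord \o u.
  apply/funext => t; rewrite /coord /u /= /scal -const_mx_scale.
  by rewrite (ext0E (emb h) (line_pt t)).
have dh : differentiable (ext0 (emb h)) (scal s) by apply: (hs 1%N).1.
have [ds dsE] : is_diff s scal scal by exact: is_diff_scalel.
have du : differentiable u s by exact: differentiable_comp.
have dc : differentiable coord (u s) by exact: differentiable_coord.
have dcu : differentiable (coord \o u) s by exact: differentiable_comp.
rewrite uE; apply: DeriveDef; first exact: diff_derivable.
rewrite deriveE // diff_comp //= diff_coord /u diff_comp //= dsE /scal scale1r.
by rewrite /tangent_map -const_mx_scale.
Qed.

Lemma line_curve_continuous (R : realType) (V : domain R) (h : line R -> V) :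
  smooth_map h -> continuous (fun t : R => \val (h (line_pt t))).
Proof.
move=> hs t.
pose scal (t : R) : 'rV[R]_1 := t *: const_mx 1.
rewrite (_ : (fun t => _) = ext0 (emb h) \o scal).
  apply: continuous_comp; first exact: scalel_continuous.
  exact: (hs 0%N).
apply/funext => s; rewrite /= /scal -const_mx_scale.
by rewrite (ext0E (emb h) (line_pt s)).
Qed.

Lemma metric_atZ (R : realType) (X : Type) (D : diffeology R X)
    (g : tangent2 D -> R) (P : plot D) (r : pdom P) (a : R) v :
  weak_riemannian g ->
  metric_at g r (a *: v) (a *: v) = a ^+ 2 * metric_at g r v v.
Proof.
move=> gR.
have gE v' := bilinear_rV v' v' (metric_linl gR r) (metric_linr gR r).
rewrite !gE mulr_sumr; apply: eq_bigr => p _; rewrite !mxE.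
by rewrite /GRing.scale /=; ring.
Qed.

(** * Length of a path that has a local lift *)

Section LiftedPath.
Variables (R : realType) (X : Type) (D : diffeology R X) (g : tangent2 D -> R).
Hypothesis gR : weak_riemannian g.
Variables (c : R -> X) (cs : smooth_path D c).

Let speed (t : R) : R :=
  Num.sqrt (metric_at g (line_pt t : pdom (path_plot cs)) (const_mx 1) (const_mx 1)).

(** The square root may destroy smoothness where the metric vanishes; continuity survives and
    suffices for a primitive. *)
Lemma speed_continuous : continuous speed.
Proof.
move=> t; pose scal (t : R) : 'rV[R]_1 := t *: const_mx 1.
pose f : line R -> R^o := fun r => metric_at g (r : pdom (path_plot cs))
  (const_mx 1) (const_mx 1).
rewrite (_ : speed = Num.sqrt \o (ext0 f \o scal)); last first.
  apply/funext => s; rewrite /= /scal -const_mx_scale.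
  by rewrite (ext0E f (line_pt s)).
apply: continuous_comp; last exact: sqrt_continuous.
apply: continuous_comp; first exact: scalel_continuous.
exact: (metric_smooth gR (P := path_plot cs) _ _ 0%N _ I).
Qed.

(* The reparametrization t0 (1 - cos s) / 2 is defined for all s, so that the
   lift becomes a curve on the whole line although J is not open. *)
Lemma lift_reparam (P : plot D) (J : set R) (ct : J -> pdom P) (t0 : R)
    (F := fun s : R => t0 / 2 * (1 - cos s)) :
  local_lift c ct -> J t0 ->
  exists2 sigma : line R -> pdom P, smooth_map sigma &
    [/\ forall (t : J) s, \val t = F s -> sigma (line_pt s) = ct t &
      forall s,
        Num.sqrt (metric_at g (sigma (line_pt s))
          (tangent_map sigma (line_pt s) (const_mx 1))
          (tangent_map sigma (line_pt s) (const_mx 1))) =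
        `|t0 / 2 * sin s| * speed (F s)].
Proof.
move=> [Jitv J01 [b b0 bJ] cts Pct] Jt0.
have J0 : J 0 by apply: bJ; rewrite /= in_itv /= lexx.
have t00 : 0 <= t0 by have := J01 _ Jt0; rewrite /= in_itv /= => /andP[].
(* [F s] lies between [0] and [t0], both in the interval [J]. *)
have JF s : J (F s).
  apply: (Jitv _ _ J0 Jt0); have := cos_le1 s; have := cos_geN1 s.
  by rewrite /F => ? ?; nra.
pose fJ (s : line R) : J := exist _ (F (\val s 0 0)) (mem_set (JF _)).
have FE (W : normedModType R) (w : W) (x : 'rV[R]_1) :
    F (x 0 0) *: w = (- (t0 / 2) * cos (x 0 0) + 0 * sin (x 0 0) + t0 / 2) *: w.
  by congr (_ *: _); rewrite /F; ring.
have FC (W : normedModType R) (w : W) :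
    forall k, Ck_on k [set: 'rV[R]_1] (fun x => F (x 0 0) *: w).
  by move=> k; rewrite (funext (FE W w)); exact: trig_Ck.
have fs : smooth ((fun s => \val (fJ s)) : line R -> R^o).
  rewrite (_ : (fun s => _) = (fun s : line R => F (\val s 0 0) *: (1 : R^o))).
    exact: smooth_line (FC _ _).
  by apply/funext => s; rewrite /= /GRing.scale /= mulr1.
(* [Q] is [c] after [F]. It maps to the path plot by [h] and to [P] by [ct \o fJ], so its metric can
   be computed on either side; this compares the speed of the lift with that of [c]. *)
pose Q : plot D := Plot (cs fs).
pose h (s : pdom Q) : pdom (path_plot cs) := line_pt (F (\val s 0 0)).
have hE : emb (h : line R -> line R) =
    fun s : line R => F (\val s 0 0) *: const_mx 1.
  by apply/funext => s; rewrite /emb /= const_mx_scale.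
have hs : smooth_map h by rewrite /smooth_map hE; exact: smooth_line (FC _ _).
have hQ : path_plot cs \o h = Q.
  by apply/funext => s; rewrite /= /line_coord /= mxE.
have h' s : tangent_map h (line_pt s) (const_mx 1) = (t0 / 2 * sin s) *: const_mx 1.
  rewrite /tangent_map hE (ext0_line (fun x => F (x 0 0) *: const_mx 1)).
  rewrite (funext (FE _ _)) trig_derive /= !mxE.
  by congr (_ *: _); ring.
exists (ct \o fJ); first exact: cts.
split=> [t s tF|s].
  congr ct; apply/val_inj; rewrite /= tF mxE //.
have PQ : P \o (ct \o fJ) = Q by apply/funext => r; rewrite /= Pct.
have := metric_at_morphism g (line_pt s : pdom Q) (const_mx 1) (const_mx 1)
  (cts _ _ fs : smooth_map (ct \o fJ : pdom Q -> pdom P)) PQ.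
rewrite (metric_at_morphism g (line_pt s : pdom Q) (const_mx 1) (const_mx 1) hs hQ).
rewrite h' => <-.
rewrite metric_atZ // sqrtrM ?sqr_ge0 // sqrtr_sqr.
by rewrite /h /= mxE.
Qed.

(** The exit bound is applied on [[0, pi]] to the reparametrized lift [sigma], where [F] runs from
    [0] to [t], and is compared with a primitive of [speed]. *)
Lemma lift_length (P : plot D) (x : pdom P) (J : set R) (ct : J -> pdom P)
    (m d : R) :
  local_lift c ct -> (forall t : J, \val t = 0 -> ct t = x) ->
  0 < m ->
  (forall r : pdom P, `|\val r - \val x| < d ->
    forall v, m * `|v| <= Num.sqrt (metric_at g r v v)) ->
  forall t : J, d <= `|\val (ct t) - \val x| -> ((m * d)%:E <= path_length g cs)%E.
Proof.
move=> lift ct0 m0 mP t0 far.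
have [sigma sigs [sigE sigspeed]] := lift_reparam lift (set_valP t0).
have [Jitv J01 [b b0 bJ] _ _] := lift.
set t : R := \val t0 in sigE sigspeed.
have [t00 t01] : 0 <= t /\ t <= 1.
  by have := J01 _ (set_valP t0); rewrite /= in_itv /= => /andP.
have J0 : J 0 by apply: bJ; rewrite /= in_itv /= lexx.
have speed0 s : 0 <= speed s by exact: sqrtr_ge0.
have [L L' intL] := continuous_primitive speed_continuous speed0 t00.
pose F (s : R) := t / 2 * (1 - cos s).
have F0 : F 0 = 0 by rewrite /F cos0; ring.
have Fpi : F pi = t by rewrite /F cospi; field.
have F' (s : R) : is_derive s 1 F (t / 2 * sin s).
  by apply: is_derive_eq; rewrite /GRing.scale /=; ring.
have Ft s : 0 <= F s <= t.
  by have := cos_le1 s; have := cos_geN1 s; rewrite /F => ? ?; nra.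
pose u (s : R) := \val (sigma (line_pt s)).
pose du (s : R) := tangent_map sigma (line_pt s) (const_mx 1).
have u0 : u 0 = \val x.
  by rewrite /u (sigE (exist _ 0 (mem_set J0))) ?ct0.
have upi : u pi = \val (ct t0) by rewrite /u (sigE t0).
have sin0 s : 0 <= s <= pi -> 0 <= t / 2 * sin s.
  by move=> spi; rewrite mulr_ge0 ?divr_ge0 ?sin_ge0_pi.
have := @exit_speed_bound R _ u du (fun s => m^-1 * L (F s))
  (fun s => m^-1 * (speed (F s) * (t / 2 * sin s))) pi d (pi_ge0 R).
(* [F s] takes the values [0] and [t] at the ends of [[0, pi]], which is why [L] has to be
   differentiable at both end points. *)
have phi' (s : R) : 0 <= s <= pi -> is_derive s 1 (fun s => m^-1 * L (F s))
    (m^-1 * (speed (F s) * (t / 2 * sin s))).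
  move=> _; have LF := L' _ (Ft s).
  exact: (is_deriveZ m^-1 (is_derive1_comp LF (F' s))).
rewrite u0 upi Fpi F0 => /(_ _ _ phi' _ _ far) bound.
have {}bound : d <= m^-1 * L t - m^-1 * L 0.
  apply: bound => [s i||s spi|s spi near_x].
  - exact: line_curve_derive.
  - exact: line_curve_continuous.
  - by rewrite /= mulr_ge0 ?invr_ge0 ?(ltW m0) // mulr_ge0 // sin0.
  rewrite /= ler_pdivlMl //; apply: le_trans (mP _ near_x _) _.
  by rewrite sigspeed ger0_norm ?sin0 // mulrC.
(* The bound concerns the path up to time [t] only; the rest of [[0, 1]] adds a nonnegative
   length. *)
apply: (@le_trans _ _ (\int[lebesgue_measure]_(s in `[0%R, t]) (speed s)%:E)%E).
  by rewrite intL lee_fin -ler_pdivlMl // mulrBr.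
rewrite /path_length; apply: ge0_subset_integral => //.
- apply: (measurable_int lebesgue_measure).
  apply: continuous_compact_integrable; first exact: segment_compact.
  exact: continuous_subspaceT speed_continuous.
- by move=> s _; rewrite lee_fin.
- by move=> s /=; rewrite !in_itv /= => /andP[-> /le_trans]; apply.
Qed.

End LiftedPath.

(** * Distinct points are at positive pseudodistance *)

Theorem theorem3p27 (R : realType) (X : Type) (D : diffeology R X)
    (g : tangent2 D -> R) (G : set (plot D)) :
  weak_riemannian g -> generating G -> definite g G -> separates_points G ->
  forall p q : X, pseudodistance g p q = 0%E -> p = q.
Proof.
move=> gR _ gdef sep p q pq0; apply: contrapT => pq.
have [P [x [e [GP e0 Px _ lifts]]]] := sep p q pq.
have [m m0 mP] := definite_lower_bound gR (gdef P GP x).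
(* The sup-norm ball of radius [d] lies inside the Euclidean one, so a lift that leaves the
   Euclidean ball also leaves this ball. *)
have /nbhs_ballP[d /= d0 dP] : nbhs (\val x) (eball (\val x) e `&`
    [set y | forall r : pdom P, \val r = y ->
      forall v, m * `|v| <= Num.sqrt (metric_at g r v v)]).
  by apply: filterI; [exact: eball_nbhs|exact: mP].
have {}dP y : `|y - \val x| < d -> eball (\val x) e y /\
    forall r : pdom P, \val r = y ->
      forall v, m * `|v| <= Num.sqrt (metric_at g r v v).
  by move=> yd; apply: dP; rewrite -ball_normE /= distrC.
(* [m] and [d] are fixed before the path is chosen, so the positive number [m * d] bounds the
   infimum. *)
suff : ((m * d)%:E <= pseudodistance g p q)%E.
  by rewrite pq0 lee_fin leNgt mulr_gt0.
apply: le_ereal_inf_tmp => _ [c [cs [c0 c1 ->]]].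
have [J [ct [lift ct0 [t tfar]]]] := lifts c cs c0 c1.
apply: (lift_length gR cs lift ct0 m0 _ (t := t)).
  by move=> r rd v; apply: (dP _ rd).2.
by rewrite leNgt; apply/negP => /dP[].
Qed.
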